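(* Let $X$ be a sequential Hausdorff space and $Y\subseteq X$ a subspace. Then the inclusion $Y\to X$ induces a topological embedding $F_q(Y)\to F_q(X)$ of free quasitopological groups (i.e. the induced homomorphism, sending each generator $y\in Y$ to $y\in X$, is a homeomorphism onto its image) if and only if $Y$ is closed in $X$.
   Context: A space is sequential if every sequentially closed subset is closed. Cross product: for topological spaces $X_1,X_2$, $X_1\otimes X_2$ is the set $X_1\times X_2$ with the topology in which $U$ is open iff $\{x\in X_1 : (x,y)\in U\}$ is open in $X_1$ for every $y\in X_2$ and $\{y\in X_2:(x,y)\in U\}$ is open in $X_2$ for every $x\in X_1$. $X^{\otimes n}$ is the $n$-fold iterated cross product of $X$ with itself (equivalently, $X^n$ with a set open iff each of its slices obtained by fixing all but one coordinate is open in $X$); $X^{\otimes 0}=\{e\}$ is a one-point space. For a space $Z$, $M_{st}(Z)=\coprod_{n\ge 0}Z^{\otimes n}$ (topological sum); its elements are written as words $z_1z_2\cdots z_n$, and it is a monoid under concatenation with identity the empty word $e$. For a space $X$, $X^{-1}$ is a homeomorphic copy of $X$ with elements written $x^{-1}$, and $X\sqcup X^{-1}$ is the topological sum. $F(X)$ is the free group on the set $X$, realized as the set of reduced words in $X\sqcup X^{-1}$, and $R:M_{st}(X\sqcup X^{-1})\to F(X)$ sends each word to its reduced form. The free quasitopological group $F_q(X)$ is $F(X)$ with the quotient topology induced by $R$. A subspace $Y\subseteq X$ carries the subspace topology, and $F_q(Y)$ is formed from that topology. *)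

(* Defs.v *)
From HB Require Import structures.
From mathcomp Require Import all_boot all_order all_algebra.
From mathcomp Require Import all_classical all_reals all_analysis.

Set Implicit Arguments.
Unset Strict Implicit.
Unset Printing Implicit Defensive.

Local Open Scope classical_set_scope.

Definition sequentially_closed (X : topologicalType) (A : set X) : Prop :=
  forall (u : nat -> X) (x : X), (forall n, A (u n)) -> u @ \oo --> x -> A x.

Definition sequential_space (X : topologicalType) : Prop :=
  forall A : set X, sequentially_closed A -> closed A.

Definition homeomorphism (S T : topologicalType) (f : S -> T) : Prop :=
  continuous f /\ exists g : T -> S, [/\ continuous g, cancel f g & cancel g f].

Definition corange (S T : Type) (f : S -> T) (x : S) : range f :=
  SigSub (mem_set (imageT f x)).

(* [range f] is coerced to the type [set_type (range f)], which carries the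
   subspace topology. *)
Definition topological_embedding (S T : topologicalType) (f : S -> T) : Prop :=
  homeomorphism (corange f).

(* [Z^n], with [U] open iff every slice of [U] obtained by fixing all the
   coordinates but one is open in [Z]; for [n = 0] it is a point. *)
Definition cross_power (n : nat) (Z : Type) : Type := n.-tuple Z.

HB.instance Definition _ (n : nat) (Z : choiceType) :=
  Choice.copy (cross_power n Z) (n.-tuple Z).

Definition set_coord (n : nat) (Z : Type) (t : cross_power n Z) (i : 'I_n)
    (z : Z) : cross_power n Z :=
  [tuple if j == i then z else tnth t j | j < n].

Section CrossTopology.
Variables (n : nat) (Z : topologicalType).

Definition cross_open (U : set (cross_power n Z)) : Prop :=
  forall (t : cross_power n Z) (i : 'I_n), open [set z | U (set_coord t i z)].

Lemma cross_openT : cross_open setT.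
Proof. by move=> t i; exact: openT. Qed.

Lemma cross_openI : setI_closed cross_open.
Proof. by move=> A B oA oB t i; exact: openI (oA t i) (oB t i). Qed.

Lemma cross_open_bigU (I : Type) (f : I -> set (cross_power n Z)) :
  (forall i, cross_open (f i)) -> cross_open (\bigcup_i f i).
Proof.
move=> of_ t i.
apply: (@bigcup_open _ _ setT (fun k => [set z | f k (set_coord t i z)])).
by move=> k _; exact: of_.
Qed.

HB.instance Definition _ := isOpenTopological.Build (cross_power n Z)
  cross_openT cross_openI cross_open_bigU.

Lemma cross_openE (U : set (cross_power n Z)) : open U = cross_open U.
Proof. by []. Qed.

End CrossTopology.

(* The topological sum over [n] of the cross powers [Z^n]. *)
Definition word (Z : Type) : Type := {n : nat & cross_power n Z}.

HB.instance Definition _ (Z : topologicalType) :=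
  Topological.copy (word Z) {n : nat & cross_power n Z}.

Lemma word_openP (Z : topologicalType) (U : set (word Z)) :
  open U <-> forall n, open [set t : cross_power n Z | U (existT _ n t)].
Proof. exact: sigT_openP. Qed.

Definition word_seq (Z : Type) (w : word Z) : seq Z := projT2 w.

(* The disjoint union of [T] (tag [false]) and of its copy of formal inverses
   (tag [true]). *)
Definition letter (T : Type) : Type := {_ : bool & T}.

HB.instance Definition _ (T : choiceType) :=
  Choice.copy (letter T) {b : bool & (fun=> T) b}.
HB.instance Definition _ (X : topologicalType) :=
  Topological.copy (letter X) {b : bool & (fun=> X) b}.

Lemma letter_openP (X : topologicalType) (U : set (letter X)) :
  open U <-> forall b, open [set x : X | U (existT _ b x)].
Proof. exact: (@sigT_openP _ (fun=> X)). Qed.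

Definition lpos (T : Type) (x : T) : letter T := existT _ false x.
Definition linv (T : Type) (l : letter T) : letter T :=
  existT _ (~~ projT1 l) (projT2 l).
Definition lmap (S T : Type) (f : S -> T) (l : letter S) : letter T :=
  existT _ (projT1 l) (f (projT2 l)).

Lemma linvK (T : Type) : involutive (@linv T).
Proof. by case=> b x; rewrite /linv /= negbK. Qed.

Section Reduction.
Variable T : choiceType.
Implicit Types (l : letter T) (w u v : seq (letter T)).

Definition reduced w : bool := sorted (fun l l' => l' != linv l) w.

Definition lcons l w : seq (letter T) :=
  if w is l' :: w' then if l' == linv l then w' else l :: w else [:: l].

(* The reduced form of a word: its letters are added from right to left, with
   a cancellation whenever a letter meets its inverse. *)
Definition reduce w : seq (letter T) := foldr lcons [::] w.

Lemma reduced_behead l w : reduced (l :: w) -> reduced w.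
Proof. by case: w => //= l' w /andP[]. Qed.

Lemma lcons_reduced l w : reduced w -> reduced (lcons l w).
Proof.
case: w => [//|l' w] pw /=; case: ifPn => [_|ne]; first exact: reduced_behead pw.
by rewrite /reduced /= ne; exact: pw.
Qed.

Lemma foldr_reduced u v : reduced v -> reduced (foldr lcons v u).
Proof. by move=> rv; elim: u => //= l u; exact: lcons_reduced. Qed.

Lemma reduce_reduced w : reduced (reduce w).
Proof. exact: foldr_reduced. Qed.

Lemma reduced_id w : reduced w -> reduce w = w.
Proof.
elim: w => //= l w IHw pw; rewrite IHw; last exact: reduced_behead pw.
by case: w pw {IHw} => //= l' w /andP[/negPf-> _].
Qed.

Lemma lconsK l w : reduced w -> lcons l (lcons (linv l) w) = w.
Proof.
case: w => [|l' w] pw /=; first by rewrite eqxx.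
rewrite linvK; case: eqP => [l'l|_] /=; last by rewrite eqxx.
by rewrite {}l'l in pw *; case: w pw => //= l'' w /andP[/negPf-> _].
Qed.

Lemma foldr_lcons l w v : reduced v ->
  foldr lcons v (lcons l w) = lcons l (foldr lcons v w).
Proof.
move=> rv; case: w => [//|l' w] /=; case: eqP => [->|//].
by rewrite lconsK//; exact: foldr_reduced.
Qed.

Lemma foldr_reduce u v : reduced v ->
  foldr lcons v (reduce u) = foldr lcons v u.
Proof. by move=> rv; elim: u => //= l u IHu; rewrite foldr_lcons// IHu. Qed.

Lemma reduce_catl u v : reduce (reduce u ++ v) = reduce (u ++ v).
Proof. by rewrite /reduce !foldr_cat foldr_reduce// reduce_reduced. Qed.

Lemma reduce_catr u v : reduce (u ++ reduce v) = reduce (u ++ v).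
Proof.
rewrite /reduce !foldr_cat; congr foldr; apply: reduced_id.
exact: reduce_reduced.
Qed.

Definition word_inv w : seq (letter T) := rev (map (@linv T) w).

Lemma word_invK : involutive word_inv.
Proof.
move=> w; rewrite /word_inv map_rev revK -map_comp -[RHS]map_id.
by apply: eq_map => l /=; rewrite linvK.
Qed.

Lemma foldr_word_inv w v : reduced v -> foldr lcons v (word_inv w ++ w) = v.
Proof.
move=> rv; elim: w => //= l w IHw.
rewrite /word_inv /= rev_cons cat_rcons foldr_cat /=.
have := @lconsK (linv l) (foldr lcons v w) (foldr_reduced w rv).
by rewrite linvK => ->; rewrite -foldr_cat.
Qed.

Lemma reduce_invl w : reduce (word_inv w ++ w) = [::].
Proof. exact: foldr_word_inv. Qed.

Lemma reduce_invr w : reduce (w ++ word_inv w) = [::].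
Proof. by rewrite -{1}[w]word_invK reduce_invl. Qed.

End Reduction.

Lemma reduce_map (S T : choiceType) (f : S -> T) (w : seq (letter S)) :
  reduce (map (lmap f) (reduce w)) = reduce (map (lmap f) w).
Proof.
elim: w => //= l w <-; case: (reduce w) => [//|l' w'] /=.
by case: eqP => [->|//] /=; rewrite lconsK//; exact: reduce_reduced.
Qed.

Record free_group (T : choiceType) : Type := FreeGroup {
  fg_seq : seq (letter T);
  fg_reduced : reduced fg_seq }.

Section FreeGroup.
Variable T : choiceType.

HB.instance Definition _ := [isSub for @fg_seq T].
HB.instance Definition _ := [Choice of free_group T by <:].

Definition reduced_form (w : seq (letter T)) : free_group T :=
  FreeGroup (reduce_reduced w).

Definition fg_one : free_group T := reduced_form [::].
Definition fg_mul (g h : free_group T) : free_group T :=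
  reduced_form (fg_seq g ++ fg_seq h).
Definition fg_inv (g : free_group T) : free_group T :=
  reduced_form (word_inv (fg_seq g)).

Lemma fg_mulA : associative fg_mul.
Proof.
by move=> g h k; apply/val_inj; rewrite /= reduce_catl reduce_catr catA.
Qed.

Lemma fg_mul1 : left_id fg_one fg_mul.
Proof. by case=> w rw; apply/val_inj; rewrite /= reduced_id. Qed.

Lemma fg_1mul : right_id fg_one fg_mul.
Proof. by case=> w rw; apply/val_inj; rewrite /= cats0 reduced_id. Qed.

Lemma fg_mulV : left_inverse fg_one fg_inv fg_mul.
Proof. by case=> w rw; apply/val_inj; rewrite /= reduce_catl reduce_invl. Qed.

Lemma fg_Vmul : right_inverse fg_one fg_inv fg_mul.
Proof. by case=> w rw; apply/val_inj; rewrite /= reduce_catr reduce_invr. Qed.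

HB.instance Definition _ := isGroup.Build (free_group T)
  fg_mulA fg_mul1 fg_1mul fg_mulV fg_Vmul.

Definition fg_gen (x : T) : free_group T := reduced_form [:: lpos x].

End FreeGroup.

(* The unique homomorphism extending [f]: see [free_group_mapM],
   [free_group_map_gen] and [free_group_map_unique]. *)
Definition free_group_map (S T : choiceType) (f : S -> T) (g : free_group S) :
    free_group T :=
  reduced_form (map (lmap f) (fg_seq g)).

Section FreeGroupMap.
Variables (S T : choiceType) (f : S -> T).
Local Open Scope group_scope.

Lemma free_group_map_gen (x : S) : free_group_map f (fg_gen x) = fg_gen (f x).
Proof. exact/val_inj. Qed.

Lemma free_group_mapM : {morph free_group_map f : g h / g * h}.
Proof.
move=> g h; apply/val_inj.
by rewrite /= reduce_map map_cat reduce_catl reduce_catr.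
Qed.

Lemma free_group_map1 : free_group_map f 1 = 1.
Proof. exact/val_inj. Qed.

HB.instance Definition _ := isUMagmaMorphism.Build
  (free_group S) (free_group T) (free_group_map f)
  (conj free_group_map1 free_group_mapM).

Lemma free_group_map_unique (h : free_group S -> free_group T) :
  {morph h : g k / g * k} -> (forall x, h (fg_gen x) = fg_gen (f x)) ->
  h =1 free_group_map f.
Proof.
move=> hM hgen.
have h1 : h 1 = 1 by apply: (mulgI (h 1)); rewrite -hM !mulg1.
have hV g : h g^-1 = (h g)^-1.
  by apply: (mulgI (h g)); rewrite -hM !mulgV.
have fV g : free_group_map f g^-1 = (free_group_map f g)^-1.
  apply: (mulgI (free_group_map f g)).
  by rewrite -free_group_mapM !mulgV free_group_map1.
move=> [w rw]; have -> : FreeGroup rw = reduced_form w.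
  by apply/val_inj; rewrite /= reduced_id.
elim: w {rw} => [|[b x] w IHw]; first exact: h1.
have -> : reduced_form (existT _ b x :: w) =
    (if b then (fg_gen x)^-1 else fg_gen x) * reduced_form w.
  by apply/val_inj; case: b; rewrite /= [RHS](reduce_catr [:: _]).
rewrite hM free_group_mapM IHw; congr (_ * _).
by case: b; rewrite ?hV ?fV hgen free_group_map_gen.
Qed.

End FreeGroupMap.

Definition Rmap (T : choiceType) (w : word (letter T)) : free_group T :=
  reduced_form (word_seq w).

(* Carries the quotient topology induced by [Rmap]. *)
Definition free_qtop_group (X : topologicalType) : Type := free_group X.

Section FreeQuasitopologicalGroup.
Variable X : topologicalType.

HB.instance Definition _ :=
  Group.copy (free_qtop_group X) (free_group X).

Definition quot_open (U : set (free_qtop_group X)) : Prop :=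
  open ((@Rmap X : word (letter X) -> free_qtop_group X) @^-1` U).

Lemma quot_openT : quot_open setT.
Proof. by rewrite /quot_open preimage_setT; exact: openT. Qed.

Lemma quot_openI : setI_closed quot_open.
Proof. by move=> A B oA oB; exact: openI. Qed.

Lemma quot_open_bigU (I : Type) (f : I -> set (free_qtop_group X)) :
  (forall i, quot_open (f i)) -> quot_open (\bigcup_i f i).
Proof.
by move=> of_; rewrite /quot_open preimage_bigcup; apply: bigcup_open => i _; exact: of_.
Qed.

HB.instance Definition _ := isOpenTopological.Build (free_qtop_group X)
  quot_openT quot_openI quot_open_bigU.

Lemma free_qtop_openE (U : set (free_qtop_group X)) : open U = quot_open U.
Proof. by []. Qed.

Lemma free_qtop_openP (U : set (free_qtop_group X)) :
  open U <->
  forall n (t : cross_power n (letter X)) (i : 'I_n) (b : bool),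
    open [set x : X | U (reduced_form (set_coord t i (existT _ b x)))].
Proof.
rewrite free_qtop_openE /quot_open word_openP.
split=> [oU n t i b|oU n].
  by have := oU n; rewrite cross_openE => /(_ t i)/letter_openP/(_ b).
by rewrite cross_openE => t i; apply/letter_openP => b; exact: oU.
Qed.

End FreeQuasitopologicalGroup.

Definition free_qtop_group_map (X Y : topologicalType) (f : X -> Y) :
    free_qtop_group X -> free_qtop_group Y :=
  free_group_map f.

(* Main.v *)
Require Import Defs.
From mathcomp Require Import all_boot all_order all_algebra.
From mathcomp Require Import all_classical all_reals all_analysis.

(** A set [C] is closed in [F_q(X)] when, for all words [u], [v] and each sign
[b], the set of the points [x] such that the reduced form of [u x^b v] is in
[C] is closed in [X] ([free_qtop_closedP]); [u] and [v] may be taken reduced.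
Then [u x^b v] is itself reduced except for finitely many [x]
([finite_nonreduced]). As points are closed, only the reduced products
matter, and a reduced product displays [u], [x] and [v] in its normal form.

If [Y] is closed, a set [C] closed in [F_q(Y)] has a closed image in [F_q(X)]
([free_qtop_group_map_closed]). When [u] and [v] are words in [Y], the set of
[x] above is contained in [Y], where it is the closed set that [C] gives. In
the other case, no reduced product [u x^b v] is in [F(Y)], so the set is
finite. Hence the continuous injection [F_q(Y) -> F_q(X)] is a closed map.

If [Y] is not closed, then, as [X] is sequential, some sequence [y_n] of [Y]
converges to a point [x] outside [Y]. As [X] is Hausdorff, adding [x] to any
set of terms of the sequence gives a closed set of [X]; thus every set of
terms is closed in [Y]. Let [Q] be the set of the elements [y_m y_n^-1] with
[y_m <> y_n]. A reduced product [u z^b v] in [Q] forces [z] to be a term of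
the sequence, so [Q] is closed in [F_q(Y)] ([closed_quotients]), and it does
not contain [1]. In [F_q(X)], however, a closed set containing [Q] contains
the limit [y_m x^-1] of [y_m y_n^-1] in [n], then the limit [x x^-1 = 1] in
[m] ([closed_quotients_one]). So [Q] is not the trace on [F(Y)] of a closed
set of [F_q(X)]. *)

Set Implicit Arguments.
Unset Strict Implicit.
Unset Printing Implicit Defensive.

Local Open Scope classical_set_scope.

(** * Topological embeddings *)

Lemma closed_set_typeP (X : topologicalType) (A : set X) (C : set (set_type A)) :
  closed C <-> exists2 D : set X, closed D & set_val @^-1` D = C.
Proof.
split=> [/closed_openC [D oD DC]|[D cD <-]].
  exists (~` D); first exact: open_closedC.
  by have := congr1 setC DC; rewrite setCK => <-.
by rewrite -openC; exists (~` D); first exact: closed_openC.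
Qed.

Lemma accessible_set_type (X : topologicalType) (A : set X) :
  accessible_space X -> accessible_space (set_type A).
Proof.
move=> aX x y xy; have [|U [oU /set_mem Ux /set_mem Uy]] := aX (val x) (val y).
  by rewrite (inj_eq val_inj).
by exists (set_val @^-1` U); split; [exists U|exact/mem_set|exact/mem_set].
Qed.

(** This necessary condition is the one by which an embedding is refuted: it
suffices to find a closed set of the source that is not such a trace. *)
Lemma embedding_closed_trace (S T : topologicalType) (f : S -> T) (C : set S) :
  topological_embedding f -> closed C ->
  exists2 D : set T, closed D & f @^-1` D = C.
Proof.
move=> [_ [g [/continuous_closedP cg fK gK]]] /cg/closed_set_typeP[D cD DC].
exists D => //; have -> : f @^-1` D = corange f @^-1` (set_val @^-1` D) by [].
by rewrite DC -comp_preimage; apply/seteqP; split=> x /=; rewrite fK.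
Qed.

Lemma closed_embedding (S T : topologicalType) (f : S -> T) :
  continuous f -> injective f ->
  (forall C : set S, closed C -> closed (f @` C)) -> topological_embedding f.
Proof.
move=> /continuous_closedP cf finj fclosed.
have rP (y : range f) : exists x, f x = set_val y.
  by have [x _ fx] := set_valP y; exists x.
have [g fgK] := choice rP.
have gK : cancel g (corange f) by move=> y; apply/val_inj; exact: fgK.
have fK : cancel (corange f) g by move=> x; apply: finj; rewrite fgK.
split; last exists g; first last.
- split=> //; apply/continuous_closedP => C /fclosed cC.
  apply/closed_set_typeP; exists (f @` C) => //.
  apply/seteqP; split=> y /=.
    move=> [x Cx fx]; have <- : corange f x = y by exact/val_inj.
    by rewrite fK.
  by move=> Cgy; exists (g y).
- by apply/continuous_closedP => _ /closed_set_typeP[D cD <-]; exact: (cf D).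
Qed.

(** * One-variable monomials over a free group *)

(** These are the functions [x |-> u x^b v] with [u] and [v] fixed: the topology
of [F_q(X)] is the finest one for which they are all continuous. *)
Definition monomial (T : choiceType) (u : seq (letter T)) (b : bool)
    (v : seq (letter T)) (x : T) : free_group T :=
  reduced_form (u ++ existT _ b x :: v).

Lemma monomial_reduce (T : choiceType) (u : seq (letter T)) b v :
  monomial (reduce u) b (reduce v) =1 monomial u b v.
Proof.
move=> x; apply/val_inj; rewrite /= reduce_catl -!cat_rcons.
exact: reduce_catr.
Qed.

(** The only possible cancellations are between [l] and a neighbour, which
would have to be its inverse. Excluding the inverse from the whole of [u] and
[v] avoids naming these neighbours. *)
Lemma reduced_insert (T : choiceType) (u v : seq (letter T)) (l : letter T) :
  reduced u -> reduced v -> linv l \notin u -> linv l \notin v ->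
  reduced (u ++ l :: v).
Proof.
have path_lv : reduced v -> linv l \notin v ->
    path (fun l l' => l' != linv l) l v.
  case: v => [//|l' v] /= rv; rewrite inE negb_or => /andP[ll' _].
  by rewrite eq_sym ll'; exact: rv.
case: u => [|a u] ru rv nu nv; first exact: path_lv.
rewrite /reduced /= cat_path; apply/andP; split; first exact: ru.
rewrite /= path_lv// andbT -(inj_eq (can_inj (@linvK T))) linvK.
by apply: contraNneq nu => ->; exact: mem_last.
Qed.

(** A letter that cancels is the inverse of a letter of [u] or [v], so its
point occurs in one of these two words. *)
Lemma finite_nonreduced (T : choiceType) (u v : seq (letter T)) (b : bool) :
  reduced u -> reduced v ->
  finite_set [set x : T | ~~ reduced (u ++ existT _ b x :: v)].
Proof.
move=> ru rv.
apply: (@sub_finite_set _ _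
    [set` [seq projT2 l | l : letter T <- u ++ v]]); last exact: finite_seq.
move=> x /=.
apply: contraR => xuv.
have nw w : {subset w <= u ++ v} -> linv (existT _ b x : letter T) \notin w.
  by move=> sw; apply: contra xuv => /sw lw; apply/mapP; exists (linv (existT _ b x)).
by apply: reduced_insert => //; apply: nw => l lw; rewrite mem_cat lw ?orbT.
Qed.

Lemma map_lmap_cat (S T : choiceType) (f : S -> T) (u v : seq (letter T)) w :
  map (lmap f) w = u ++ v ->
  exists u' v', [/\ w = u' ++ v', map (lmap f) u' = u & map (lmap f) v' = v].
Proof.
move=> wuv; exists (take (size u) w), (drop (size u) w).
by rewrite cat_take_drop map_take map_drop wuv take_size_cat// drop_size_cat.
Qed.

Section InjectiveMap.
Variables (S T : choiceType) (f : S -> T).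
Hypothesis finj : injective f.

Lemma lmap_inj : injective (lmap f).
Proof. by move=> [b x] [c y] /= [-> /finj ->]. Qed.

Lemma map_lmap_reduced (w : seq (letter S)) :
  reduced (map (lmap f) w) = reduced w.
Proof.
rewrite /reduced sorted_map; apply: eq_sorted => l l' /=.
by rewrite -[linv (lmap f l)]/(lmap f (linv l)) (inj_eq lmap_inj).
Qed.

Lemma fg_seq_map (g : free_group S) :
  fg_seq (free_group_map f g) = map (lmap f) (fg_seq g).
Proof. by apply: reduced_id; rewrite map_lmap_reduced; case: g. Qed.

Lemma free_group_map_inj : injective (free_group_map f).
Proof.
move=> g h /(congr1 (@fg_seq T)); rewrite !fg_seq_map => /(inj_map lmap_inj).
exact: val_inj.
Qed.

End InjectiveMap.

Lemma free_group_map_reduced_form (S T : choiceType) (f : S -> T) w :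
  free_group_map f (reduced_form w) = reduced_form (map (lmap f) w).
Proof. by apply/val_inj; rewrite /= reduce_map. Qed.

Lemma free_group_map_monomial (S T : choiceType) (f : S -> T) u b v x :
  free_group_map f (monomial u b v x) =
  monomial (map (lmap f) u) b (map (lmap f) v) (f x).
Proof. by rewrite free_group_map_reduced_form map_cat. Qed.

(** * Closed sets of the free quasitopological group *)

Lemma set_coord_cat (n : nat) (Z : Type) (t : cross_power n Z) (i : 'I_n) z :
  set_coord t i z = take i t ++ z :: drop i.+1 t :> seq Z.
Proof.
have it : (i <= size t)%N by rewrite size_tuple ltnW.
apply: (@eq_from_nth _ z) => [|k].
  rewrite size_tuple size_cat /= size_takel// size_drop size_tuple -addSnnS.
  by rewrite subnKC.
rewrite size_tuple => kn.
rewrite -(tnth_nth z _ (Ordinal kn)) tnth_mktuple -val_eqE /= nth_cat size_takel//.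
rewrite (tnth_nth z) /=; have [ki|ik|->] := ltngtP k i.
- by rewrite nth_take.
- rewrite -[(k - i)%N]prednK ?subn_gt0//= nth_drop.
  by rewrite -subnS subnKC.
- by rewrite subnn.
Qed.

(** Varying one coordinate of a tuple of letters splits it as a prefix, the
free letter and a suffix. *)
Lemma free_qtop_closedP (X : topologicalType) (C : set (free_qtop_group X)) :
  closed C <-> forall u b v, closed (monomial u b v @^-1` C).
Proof.
rewrite -openC free_qtop_openP; split=> [oC u b v|cC n t i b]; last first.
  rewrite (_ : mkset _ = ~` (monomial (take i t) b (drop i.+1 t) @^-1` C)).
    exact/closed_openC/cC.
  by apply/seteqP; split=> x /=; rewrite /monomial -set_coord_cat.
rewrite -openC.
(* A point [x0] is needed as the initial value of the varying coordinate,
   and [X] may be empty. *)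
have [->|/set0P[x0 _]] := eqVneq (~` (monomial u b v @^-1` C)) set0.
  exact: open0.
pose t : cross_power _ (letter X) := in_tuple (u ++ existT _ b x0 :: v).
have iP : (size u < size (u ++ existT _ b x0 :: v : seq (letter X)))%N.
  by rewrite size_cat addnS ltnS leq_addr.
have := oC _ t (Ordinal iP) b; congr open.
have dE : drop (size u).+1 (u ++ existT _ b x0 :: v : seq (letter X)) = v.
  by rewrite -cat_rcons drop_size_cat// size_rcons.
by apply/seteqP; split=> x /=; rewrite set_coord_cat /= take_size_cat// dE.
Qed.

Lemma free_qtop_closed_reduced (X : topologicalType)
    (C : set (free_qtop_group X)) :
  (forall u b v, reduced u -> reduced v -> closed (monomial u b v @^-1` C)) ->
  closed C.
Proof.
move=> cC; apply/free_qtop_closedP => u b v.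
have -> : monomial u b v = monomial (reduce u) b (reduce v).
  by apply/funext => x; rewrite monomial_reduce.
by apply: cC; exact: reduce_reduced.
Qed.

(** In a T1 space, the finitely many points for which cancellation occurs do
not affect closedness, whether or not their monomials are in [C]. *)
Lemma closed_monomial_reduced (X : topologicalType) (C : set (free_qtop_group X))
    u b v :
  accessible_space X -> reduced u -> reduced v ->
  closed [set x | reduced (u ++ existT _ b x :: v) /\ C (monomial u b v x)] ->
  closed (monomial u b v @^-1` C).
Proof.
move=> aX ru rv cr.
pose N := [set x | ~~ reduced (u ++ existT _ b x :: v)].
rewrite (_ : _ @^-1` _ = (N `&` monomial u b v @^-1` C) `|`
  [set x | reduced (u ++ existT _ b x :: v) /\ C (monomial u b v x)]).
  apply: closedU => //; apply: (accessible_finite_set_closed.1 aX).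
  exact/finite_setIl/finite_nonreduced.
apply/seteqP; split=> x /=; last by case=> -[].
by move=> Cx; case: (boolP (reduced (u ++ existT _ b x :: v))) => r; [right|left].
Qed.

(** * The map induced by a closed embedding *)

Lemma free_qtop_group_map_continuous (S T : topologicalType) (f : S -> T) :
  continuous f -> continuous (free_qtop_group_map f).
Proof.
move=> /continuous_closedP cf.
apply/continuous_closedP => C /free_qtop_closedP cC.
apply/free_qtop_closedP => u b v.
have := cf _ (cC (map (lmap f) u) b (map (lmap f) v)); congr closed.
by apply/seteqP; split=> x /=; rewrite /free_qtop_group_map free_group_map_monomial.
Qed.

(** Under an injective [f], words stay reduced, so the normal form of an element
of the image is a word in the range of [f], and so is each of its factors. *)
Lemma monomial_in_range (S T : choiceType) (f : S -> T) g u b v x :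
  injective f -> reduced (u ++ existT _ b x :: v) ->
  free_group_map f g = monomial u b v x ->
  [/\ range (map (lmap f)) u, range f x & range (map (lmap f)) v].
Proof.
move=> finj ruv /(congr1 (@fg_seq T)); rewrite fg_seq_map//= reduced_id//.
move=> /map_lmap_cat[u' [[|[c s] v'] [_ u'E //]]] [cb sx v'E].
by split; [exists u'|exists s|exists v'].
Qed.

(** The preimage of the image of [C] under a monomial with coefficients [u] and
[v] is the image of a closed set if both are words in the range of [f], and
is contained in the finite set of cancelling points otherwise. *)
Lemma free_qtop_group_map_closed (S T : topologicalType) (f : S -> T) :
  accessible_space T -> injective f ->
  (forall A : set S, closed A -> closed (f @` A)) ->
  forall C : set (free_qtop_group S), closed C ->
  closed (free_qtop_group_map f @` C).
Proof.
move=> aT finj fclosed C /free_qtop_closedP cC.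
apply: free_qtop_closed_reduced => u b v ru rv.
have [[[u' _ u'E] [v' _ v'E]]|nuv] :=
    pselect (range (map (lmap f)) u /\ range (map (lmap f)) v); last first.
  apply: closed_monomial_reduced => //.
  rewrite (_ : mkset _ = set0); first exact: closed0.
  rewrite -subset0 => x [ruv [g _ /monomial_in_range]].
  by move=> /(_ finj ruv)[uE _ vE]; apply: nuv.
(* All the points are in the range of [f]: a point outside it cancels with no
   letter of [u] or [v], hence remains in the normal form. *)
rewrite (_ : _ @^-1` _ = f @` (monomial u' b v' @^-1` C)).
  exact/fclosed/cC.
apply/seteqP; split=> x /=; last first.
  move=> [s Cs <-]; exists (monomial u' b v' s) => //.
  by rewrite -u'E -v'E; exact: free_group_map_monomial.
move=> [g Cg gE]; have [s _ sx] : range f x.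
  apply: contrapT => nx.
  have nw w : linv (existT _ b x : letter T) \notin map (lmap f) w.
    by apply/mapP => -[[c s] _ [_ xs]]; apply: nx; exists s.
  have ruv : reduced (u ++ existT _ b x :: v).
    by apply: reduced_insert => //; rewrite -?u'E -?v'E.
  by have [] := monomial_in_range finj ruv gE.
exists s => //; suff <- : g = monomial u' b v' s by [].
apply: (free_group_map_inj finj).
by rewrite free_group_map_monomial u'E v'E sx.
Qed.

(** * Quotients of the terms of a convergent sequence *)

Definition quotients (T : choiceType) (y : nat -> T) : set (free_group T) :=
  [set g | exists m n, y m != y n /\
    g = reduced_form [:: lpos (y m); linv (lpos (y n))]].

Lemma quotients_neq1 (T : choiceType) (y : nat -> T) : ~ quotients y (fg_one T).
Proof.
move=> [m [n [mn /(congr1 (@fg_seq T))]]] /=.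
by case: eqP => // -[/esym/eqP]; rewrite (negPf mn).
Qed.

(** A reduced product [u x^b v] equal to [y_m y_n^-1] has [x] among its two
points. So the preimages of the quotients under monomials are, up to finitely
many points, contained in the range of [y]. *)
Lemma closed_quotients (X : topologicalType) (y : nat -> X) :
  accessible_space X -> (forall A : set X, A `<=` range y -> closed A) ->
  closed (quotients y : set (free_qtop_group X)).
Proof.
move=> aX yclosed; apply: free_qtop_closed_reduced => u b v ru rv.
apply: closed_monomial_reduced => //; apply: yclosed => x /= [ruv].
move=> [m [n [mn /(congr1 (@fg_seq X))]]]; rewrite /= (reduced_id ruv).
case: eqP => [[/esym/eqP]|_ uxv]; first by rewrite (negPf mn).
have : (existT _ b x : letter X) \in u ++ existT _ b x :: v.
  by rewrite mem_cat mem_head orbT.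
rewrite uxv !inE => /orP[]/eqP[_ ->]; [by exists m|by exists n].
Qed.

(** Two successive limits along single coordinates: [y_m y_n^-1] tends to
[y_m x^-1] in [n], and then [y_m x^-1] tends to [x x^-1] in [m]. *)
Lemma closed_quotients_one (X : topologicalType) (y : nat -> X) (x : X)
    (D : set (free_qtop_group X)) :
  accessible_space X -> y @ \oo --> x -> (forall n, y n != x) -> closed D ->
  quotients y `<=` D -> D (fg_one X).
Proof.
move=> aX yx ynx /free_qtop_closedP cD yD.
have Dyx m : D (reduced_form [:: lpos (y m); linv (lpos x)]).
  apply: (closed_cvg _ (cD [:: lpos (y m)] true [::]) _ x yx).
  (* The quotient has to have [y m != y n], which holds for [n] large since
     [y n] is then in a neighbourhood of [x] that avoids [y m]. *)
  have [U [oU /set_mem Ux /set_mem Uy]] : exists A : set X,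
    [/\ open A, x \in A & y m \in ~` A] by apply: aX; rewrite eq_sym.
  have : \forall n \near \oo, U (y n) by apply: yx; exact: open_nbhs_nbhs.
  apply: filterS => n Un; apply: yD; exists m, n; split=> //.
  by apply: contra_notN Uy => /eqP ->.
have -> : fg_one X = monomial [::] false [:: linv (lpos x)] x.
  by apply/val_inj; rewrite /= eqxx.
apply: (closed_cvg _ (cD [::] false [:: linv (lpos x)]) _ x yx).
by apply: nearW => m; exact: Dyx.
Qed.

(** Away from [x], a neighbourhood disjoint from one of [x] meets only finitely
many terms of the sequence. *)
Lemma closed_cvg_range (X : topologicalType) (y : nat -> X) (x : X) (A : set X) :
  hausdorff_space X -> y @ \oo --> x -> A `<=` range y ->
  closed (A `|` [set x]).
Proof.
rewrite open_hausdorff => hX yx Ay z Az.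
have [->|zx] := eqVneq z x; first by right.
have [[U V] /= [/set_mem Uz /set_mem Vx] [oU oV /eqP UV0]] := hX _ _ zx.
have [N _ NV] : \forall n \near \oo, V (y n) by apply: yx; exact: open_nbhs_nbhs.
left; suff [] : (A `&` y @` `I_N) z by [].
have /accessible_finite_set_closed : accessible_space X.
  by apply: hausdorff_accessible; rewrite open_hausdorff.
apply; first exact/finite_setIr/finite_image/finite_II.
move=> B Bz; have [|w [Axw [Bw Uw]]] := Az (B `&` U).
  by apply: filterI => //; exact: open_nbhs_nbhs.
have nVw : ~ V w by move=> Vw; rewrite -[False]/(set0 w) -UV0.
exists w; split=> //; case: Axw => [Aw|wx]; last by case: nVw; rewrite wx.
split=> //; have [n _ yn] := Ay _ Aw; exists n => //=.
by rewrite ltnNge; apply/negP => /NV; rewrite /= yn.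
Qed.

Theorem theorem6p2 (X : topologicalType) (Y : set X) :
  sequential_space X -> hausdorff_space X ->
  (topological_embedding (free_qtop_group_map (set_val : set_type Y -> X))
   <-> closed Y).
Proof.
move=> seqX hX; have aX := hausdorff_accessible hX.
split=> [emb|cY]; last first.
  have vclosed (A : set (set_type Y)) : closed A -> closed (set_val @` A).
    move=> /closed_set_typeP[D cD <-].
    rewrite (_ : _ @` _ = D `&` Y); first exact: closedI.
    apply/seteqP; split=> x /=; first by move=> [z Dz <-]; split=> //; exact: set_valP.
    by move=> [Dx Yx]; exists (SigSub (mem_set Yx)).
  apply: closed_embedding.
  - exact/free_qtop_group_map_continuous/initial_continuous.
  - exact/free_group_map_inj/val_inj.
  - exact/free_qtop_group_map_closed/vclosed/val_inj.
apply: seqX => u x uY ux; apply: contrapT => Yx.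
pose y n : set_type Y := SigSub (mem_set (uY n)).
have cQ : closed (quotients y : set (free_qtop_group (set_type Y))).
  apply: closed_quotients => [|A Ay]; first exact: accessible_set_type.
  apply/closed_set_typeP; exists (set_val @` A `|` [set x]).
    by apply: closed_cvg_range ux _ => // _ [z /Ay[n _ <-] <-]; exists n.
  apply/seteqP; split=> z /=; last by left; exists z.
  by case=> [[z' Az' /val_inj <-]//|zx]; case: Yx; rewrite -zx; exact: set_valP.
have [D cD DQ] := embedding_closed_trace emb cQ.
have : quotients y (fg_one (set_type Y)).
  rewrite -DQ /preimage /= /free_qtop_group_map free_group_map_reduced_form.
  apply: (closed_quotients_one aX ux) => //.
    by move=> n; apply/eqP => unx; apply: Yx; rewrite -unx.
  move=> _ [m [n [mn ->]]].
  have : quotients y (reduced_form [:: lpos (y m); linv (lpos (y n))]).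
    by exists m, n; split=> //; rewrite -(inj_eq val_inj).
  by rewrite -DQ /preimage /= /free_qtop_group_map free_group_map_reduced_form.
exact: quotients_neq1.
Qed.
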